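(* For every signature $\sigma$ and every problem $\Omega$ over $\sigma$ that is accepted by some program scheme of $\mathrm{NPSB}(1)$, there is a quantifier-free first-order translation with 2 constants from $\Omega$ to the problem $\Omega_b$. Hence $\Omega_b$ is complete for $\mathrm{NPSB}(1)$ via quantifier-free first-order translations with 2 constants (in particular, $\Omega_b$ is itself accepted by a program scheme of $\mathrm{NPSB}(1)$).
   Context: All structures are finite with at least two elements; a problem over a signature $\sigma$ is a class of finite $\sigma$-structures closed under isomorphism. Program schemes of $\mathrm{NPSA}(1)$ over $\sigma$: a scheme uses variables $x_1,\dots,x_k$ and finitely many array symbols, each of some dimension $d\ge 1$. It is a finite sequence of instructions, the first being $\mathtt{input}(x_1,\dots,x_l)$ and the last $\mathtt{output}(x_1,\dots,x_l)$ ($1\le l\le k$); every other instruction is an assignment $x_i:=y$, $x_i:=A[y_1,\dots,y_d]$ or $A[y_1,\dots,y_d]:=y_0$ (each $y_j$ a variable, a constant symbol of $\sigma$, or one of two special constant symbols $0$, $max$), a guess $\mathtt{guess}\ x_i$, or a while instruction $\mathtt{while}\ \varphi\ \mathtt{do}\ \alpha_1;\dots;\alpha_q\ \mathtt{od}$ with $\varphi$ a quantifier-free first-order formula over $\sigma\cup\{0,max\}$ with free variables among the $x_i$ and each $\alpha_j$ again an instruction of these kinds. $x_1,\dots,x_l$ are the input-output variables; $x_{l+1},\dots,x_k$ are free variables, which never occur on the left of an assignment or in a guess. On input a $\sigma$-structure $\mathcal A$ expanded by a value for each free variable: $0$ and $max$ denote two arbitrary distinct elements of $|\mathcal A|$;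 initially all input-output variables and all array elements equal $0$; a guess assigns an arbitrary element of $|\mathcal A|$ nondeterministically; the input is accepted iff some computation reaches the output instruction with all input-output variables equal to $max$. Only schemes whose acceptance is independent of the choice of distinct values for $0$ and $max$ are admitted. $\mathrm{NPSB}(1)$ is the subclass of $\mathrm{NPSA}(1)$ in which every assignment with an array element on its left-hand side has the form $A[y_1,\dots,y_d]:=max$. A scheme without free variables accepts a problem. The problem $\Omega_b$: let $\sigma_b=\langle P,Q,T_1,T_2,T_3,C,D\rangle$ with $P,Q$ unary, $T_1,T_2,T_3$ of arities 2,3,4, and $C,D$ constants. A $\sigma_b$-structure $\mathcal P$ is read as a Petri net whose places are the elements of $|\mathcal P|$, with transitions: $(\{u\},\{v\})$ for $u,v\in P$ with $T_1(u,v)$; $(\{u,i\},\{v,i\})$ for $u,v\in P$, $i\notin P$, $i\in Q$ with $T_2(u,v,i)$; $(\{u,j\},\{v,j\})$ for $u,v\in P$, $j\notin P$, $j\notin Q$ with $T_2(u,v,j)$; and $(\{u,i\},\{v,j\})$ for $u,v\in P$, $i,j\notin P$, $i\in Q$, $j\notin Q$ with $T_3(u,v,i,j)$ (a transition (input places, output places) is enabled when each input place holds a token, and firing removes one token from each input place and adds one to each output place). The initial marking has one token on $C$ and one token on each place not in $P$ but in $Q$, and no others. $\Omega_b$ consists of those $\sigma_b$-structures in which some marking reachable from the initial marking has at least one token on $D$. A quantifier-free first-order translation with 2 constants from a problem $\Omega$ over $\sigma$ to $\Omega_b$ is given by some $k\ge1$, quantifier-free first-order formulas $\psi_P(\mathbf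 x),\psi_Q(\mathbf x),\psi_1(\mathbf x,\mathbf y),\psi_2(\mathbf x,\mathbf y,\mathbf z),\psi_3(\mathbf x,\mathbf y,\mathbf z,\mathbf w)$ over $\sigma\cup\{0,max\}$ with $\mathbf x,\mathbf y,\mathbf z,\mathbf w$ disjoint $k$-tuples of variables, and two $k$-tuples $\mathbf u,\mathbf v$ of constant symbols of $\sigma\cup\{0,max\}$; it maps a $\sigma$-structure $\mathcal A$ (with distinct values chosen for $0$, $max$) to the $\sigma_b$-structure with universe $|\mathcal A|^k$, $P=\{\mathbf a:\mathcal A\models\psi_P(\mathbf a)\}$, $Q$, $T_1$, $T_2$, $T_3$ defined likewise by $\psi_Q,\psi_1,\psi_2,\psi_3$, and $C,D$ the interpretations of $\mathbf u,\mathbf v$; and it is required that for all $\mathcal A$ and all choices of distinct $0,max$: $\mathcal A\in\Omega$ iff the image is in $\Omega_b$. *)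

(* Defs.v *)
From HB Require Import structures.
From mathcomp Require Import all_boot.
From Stdlib Require Import Relation_Operators.

Set Implicit Arguments.
Unset Strict Implicit.
Unset Printing Implicit Defensive.

(* A signature is a finite tuple of relation symbols, given by the list of
   their arities, and of constant symbols, given by their number. *)
Record signature := Signature { arities : seq nat; ncst : nat }.

Definition rsym (sg : signature) := 'I_(size (arities sg)).
Definition arity (sg : signature) (r : rsym sg) : nat := nth 0 (arities sg) r.

Record structure (sg : signature) := MkStructure {
  carrier :> finType;
  carrier_gt1 : 1 < #|carrier|;
  rint : forall r : rsym sg, pred ((arity r).-tuple carrier);
  cint : 'I_(ncst sg) -> carrier
}.

Definition isomorphism (sg : signature) (A B : structure sg) (f : A -> B) :=
  [/\ bijective f,
      forall (r : rsym sg) (t : (arity r).-tuple A),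
        rint (map_tuple f t) = rint t
    & forall c : 'I_(ncst sg), f (cint A c) = cint B c].

Definition isomorphic (sg : signature) (A B : structure sg) :=
  exists f : A -> B, isomorphism f.

Record problem (sg : signature) := Problem {
  instance_in :> structure sg -> Prop;
  instance_iso : forall A B : structure sg,
    isomorphic A B -> instance_in A -> instance_in B
}.

(* Constant symbols of sg extended with 0 and max. *)
Inductive csym (sg : signature) :=
| SigCst of 'I_(ncst sg)
| Zero
| Max.
Arguments Zero {sg}.
Arguments Max {sg}.

Inductive term (sg : signature) (V : Type) :=
| Var of V
| Cst of csym sg.
Arguments Var {sg V} v.
Arguments Cst {sg V} c.

Inductive qff (sg : signature) (V : Type) :=
| FRel (r : rsym sg) of (arity r).-tuple (term sg V)
| FEq of term sg V & term sg V
| FNot of qff sg V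
| FAnd of qff sg V & qff sg V
| FOr of qff sg V & qff sg V.

Section FormulaSemantics.
Variables (sg : signature) (A : structure sg) (zero max : A).

Definition csym_val (c : csym sg) : A :=
  match c with
  | SigCst c => cint A c
  | Zero => zero
  | Max => max
  end.

Variables (V : Type) (e : V -> A).

Definition term_val (t : term sg V) : A :=
  match t with
  | Var v => e v
  | Cst c => csym_val c
  end.

Fixpoint holds (f : qff sg V) : bool :=
  match f with
  | FRel _ ts => rint (map_tuple term_val ts)
  | FEq t u => term_val t == term_val u
  | FNot g => ~~ holds g
  | FAnd g h => holds g && holds h
  | FOr g h => holds g || holds h
  end.

End FormulaSemantics.

(* [nio] input-output variables, [nfree] free variables, one array symbol per
   entry of [dims]. Targets of assignments and guesses range over 'I_nio, so
   free variables are never modified. *)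
Definition pvar (nio nfree : nat) : Type := ('I_nio + 'I_nfree)%type.
Definition asym (dims : seq nat) := 'I_(size dims).
Definition dim (dims : seq nat) (a : asym dims) : nat := nth 0 dims a.

Inductive instr (sg : signature) (nio nfree : nat) (dims : seq nat) :=
| Assign of 'I_nio & term sg (pvar nio nfree)
| ArrRead (i : 'I_nio) (a : asym dims) of
    (dim a).-tuple (term sg (pvar nio nfree))
| ArrWrite (a : asym dims) of
    (dim a).-tuple (term sg (pvar nio nfree)) & term sg (pvar nio nfree)
| Guess of 'I_nio
| While of qff sg (pvar nio nfree) & seq (instr sg nio nfree dims).

(* The sequence of instructions strictly between input(x_1, ..., x_l) and
   output(x_1, ..., x_l), where l = nio. *)
Record scheme (sg : signature) := Scheme {
  nio : nat;
  nfree : nat;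
  dims : seq nat;
  nio_gt0 : 0 < nio;
  dims_gt0 : all (leq 1) dims;
  body : seq (instr sg nio nfree dims)
}.

Fixpoint instr_npsb (sg : signature) (l m : nat) (ds : seq nat)
    (i : instr sg l m ds) : bool :=
  match i with
  | ArrWrite _ _ y0 => if y0 is Cst Max then true else false
  | While _ b => all (@instr_npsb sg l m ds) b
  | _ => true
  end.

Section SchemeSemantics.
Variables (sg : signature) (l m : nat) (ds : seq nat).
Variables (A : structure sg) (zero max : A) (fv : {ffun 'I_m -> A}).

(* An element A[t_1, ..., t_d] of an array. *)
Definition cell : finType := {a : asym ds & (dim a).-tuple A}.

Record state := State { vars : {ffun 'I_l -> A}; arrs : {ffun cell -> A} }.

Definition env (s : state) (x : pvar l m) : A :=
  match x with
  | inl i => vars s i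
  | inr j => fv j
  end.

Definition set_var (s : state) (i : 'I_l) (v : A) : state :=
  State [ffun j => if j == i then v else vars s j] (arrs s).

Definition set_cell (s : state) (c : cell) (v : A) : state :=
  State (vars s) [ffun c' => if c' == c then v else arrs s c'].

Definition pterm_val (s : state) := term_val zero max (env s).

Definition cell_val (s : state) (a : asym ds)
    (ts : (dim a).-tuple (term sg (pvar l m))) : cell :=
  Tagged (fun a : asym ds => (dim a).-tuple A) (map_tuple (pterm_val s) ts).

(* The instructions still to be executed before output, and the memory. *)
Definition config : Type := (seq (instr sg l m ds) * state)%type.

Inductive step : config -> config -> Prop :=
| StepAssign i y k s :
    step (Assign ds i y :: k, s) (k, set_var s i (pterm_val s y))
| StepArrRead i (a : asym ds) (ts : (dim a).-tuple (term sg (pvar l m))) k s :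
    step (ArrRead i ts :: k, s) (k, set_var s i (arrs s (cell_val s ts)))
| StepArrWrite (a : asym ds) (ts : (dim a).-tuple (term sg (pvar l m))) y k s :
    step (ArrWrite ts y :: k, s)
         (k, set_cell s (cell_val s ts) (pterm_val s y))
| StepGuess i v k s :
    step (Guess sg m ds i :: k, s) (k, set_var s i v)
| StepWhileTrue f b k s of holds zero max (env s) f :
    step (While f b :: k, s) (b ++ While f b :: k, s)
| StepWhileFalse f b k s of ~~ holds zero max (env s) f :
    step (While f b :: k, s) (k, s).

Definition init_state : state := State [ffun=> zero] [ffun=> zero].

End SchemeSemantics.

Definition accepts (sg : signature) (rho : scheme sg) (A : structure sg)
    (zero max : A) (fv : {ffun 'I_(nfree rho) -> A}) : Prop :=
  exists2 s : state (nio rho) (dims rho) A,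
    clos_refl_trans _ (step zero max fv)
      (body rho, init_state (nio rho) (dims rho) zero) ([::], s)
    & forall i, vars s i = max.

Definition NPSA1 (sg : signature) (rho : scheme sg) : Prop :=
  forall (A : structure sg) (fv : {ffun 'I_(nfree rho) -> A})
         (zero max zero' max' : A),
    zero != max -> zero' != max' ->
    (accepts zero max fv <-> accepts zero' max' fv).

Definition NPSB1 (sg : signature) (rho : scheme sg) : Prop :=
  NPSA1 rho /\ all (@instr_npsb _ _ _ _) (body rho).

(* When [nfree rho = 0] there is exactly one [fv]. *)
Definition accepts_problem (sg : signature) (rho : scheme sg)
    (Omega : problem sg) : Prop :=
  nfree rho = 0 /\
  forall (A : structure sg) (fv : {ffun 'I_(nfree rho) -> A}) (zero max : A),
    zero != max -> (Omega A <-> accepts zero max fv).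

Definition in_NPSB1 (sg : signature) (Omega : problem sg) : Prop :=
  exists2 rho : scheme sg, NPSB1 rho & accepts_problem rho Omega.

(* The variable (i, j) is the j-th component of the i-th tuple. *)
Record qf_translation (sg tau : signature) := QfTranslation {
  width : nat;
  width_gt0 : 0 < width;
  tr_rel : forall r : rsym tau, qff sg ('I_(arity r) * 'I_width);
  tr_cst : 'I_(ncst tau) -> width.-tuple (csym sg)
}.

Lemma card_tuple_gt1 (T : finType) (k : nat) :
  0 < k -> 1 < #|T| -> 1 < #|{: k.-tuple T}|.
Proof. by move=> k0 T1; rewrite card_tuple -(exp1n k) ltn_exp2r. Qed.

Definition translate (sg tau : signature) (tr : qf_translation sg tau)
    (A : structure sg) (zero max : A) : structure tau :=
  @MkStructure tau {: (width tr).-tuple A}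
    (card_tuple_gt1 (width_gt0 tr) (carrier_gt1 A))
    (fun r ts => holds zero max (fun ij => tnth (tnth ts ij.1) ij.2)
                   (tr_rel tr r))
    (fun c => map_tuple (csym_val zero max) (tr_cst tr c)).

Definition is_translation (sg tau : signature) (tr : qf_translation sg tau)
    (Omega : problem sg) (Omega' : problem tau) : Prop :=
  forall (A : structure sg) (zero max : A), zero != max ->
    (Omega A <-> Omega' (translate tr zero max)).

Definition qf_translates (sg tau : signature)
    (Omega : problem sg) (Omega' : problem tau) : Prop :=
  exists tr : qf_translation sg tau, is_translation tr Omega Omega'.

Definition NPSB1_complete (tau : signature) (Omega' : problem tau) : Prop :=
  in_NPSB1 Omega' /\
  forall (sg : signature) (Omega : problem sg),
    in_NPSB1 Omega -> qf_translates Omega Omega'.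

Section PetriNets.
Variables (T : finType) (trans : {set T} -> {set T} -> Prop).

Definition marking := {ffun T -> nat}.

Definition enabled (I : {set T}) (M : marking) : Prop :=
  forall p, p \in I -> 0 < M p.

Definition fire (I O : {set T}) (M : marking) : marking :=
  [ffun p => M p - (p \in I) + (p \in O)].

Inductive fires (M : marking) : marking -> Prop :=
| Fires I O of trans I O & enabled I M : fires M (fire I O M).

Definition reachable : marking -> marking -> Prop := clos_refl_trans _ fires.

End PetriNets.

(* Relation symbols P, Q, T_1, T_2, T_3 and constant symbols C, D. *)
Definition sigma_b : signature := Signature [:: 1; 1; 2; 3; 4] 2.

Section NetOfStructure.
Variable N : structure sigma_b.

Definition bP (u : N) : bool :=
  @rint _ N (@Ordinal 5 0 isT) [tuple u].
Definition bQ (u : N) : bool :=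
  @rint _ N (@Ordinal 5 1 isT) [tuple u].
Definition bT1 (u v : N) : bool :=
  @rint _ N (@Ordinal 5 2 isT) [tuple u; v].
Definition bT2 (u v i : N) : bool :=
  @rint _ N (@Ordinal 5 3 isT) [tuple u; v; i].
Definition bT3 (u v i j : N) : bool :=
  @rint _ N (@Ordinal 5 4 isT) [tuple u; v; i; j].
Definition bC : N := cint N (@Ordinal 2 0 isT).
Definition bD : N := cint N (@Ordinal 2 1 isT).

Inductive transition_b : {set N} -> {set N} -> Prop :=
| TransT1 u v of bP u & bP v & bT1 u v :
    transition_b [set u] [set v]
| TransT2Q u v i of bP u & bP v & ~~ bP i & bQ i & bT2 u v i :
    transition_b [set u; i] [set v; i]
| TransT2NQ u v j of bP u & bP v & ~~ bP j & ~~ bQ j & bT2 u v j :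
    transition_b [set u; j] [set v; j]
| TransT3 u v i j of bP u & bP v & ~~ bP i & ~~ bP j & bQ i & ~~ bQ j
    & bT3 u v i j :
    transition_b [set u; i] [set v; j].

Definition init_marking_b : marking N :=
  [ffun p => nat_of_bool ((p == bC) || (~~ bP p && bQ p))].

Definition in_Omega_b : Prop :=
  exists2 M : marking N, reachable transition_b init_marking_b M & 0 < M bD.

End NetOfStructure.

Section OmegaBIso.
Variables (A B : structure sigma_b) (f : A -> B) (g : B -> A).
Hypotheses (isof : isomorphism f) (fK : cancel f g) (gK : cancel g f).

Let fR := let: And3 _ fR _ := isof in fR.
Let fC := let: And3 _ _ fC := isof in fC.

Lemma bP_iso u : bP (f u) = bP u.
Proof. by rewrite /bP -fR; congr rint; apply: val_inj. Qed.
Lemma bQ_iso u : bQ (f u) = bQ u.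
Proof. by rewrite /bQ -fR; congr rint; apply: val_inj. Qed.
Lemma bT1_iso u v : bT1 (f u) (f v) = bT1 u v.
Proof. by rewrite /bT1 -fR; congr rint; apply: val_inj. Qed.
Lemma bT2_iso u v i : bT2 (f u) (f v) (f i) = bT2 u v i.
Proof. by rewrite /bT2 -fR; congr rint; apply: val_inj. Qed.
Lemma bT3_iso u v i j : bT3 (f u) (f v) (f i) (f j) = bT3 u v i j.
Proof. by rewrite /bT3 -fR; congr rint; apply: val_inj. Qed.

Lemma transition_b_iso I O :
  transition_b I O -> transition_b (f @: I) (f @: O).
Proof.
case=> [u v Pu Pv T|u v i Pu Pv Pi Qi T|u v j Pu Pv Pj Qj T
       |u v i j Pu Pv Pi Pj Qi Qj T]; rewrite ?imsetU ?imset_set1.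
- by apply: TransT1; rewrite ?bP_iso ?bT1_iso.
- by apply: TransT2Q; rewrite ?bP_iso ?bQ_iso ?bT2_iso.
- by apply: TransT2NQ; rewrite ?bP_iso ?bQ_iso ?bT2_iso.
- by apply: TransT3; rewrite ?bP_iso ?bQ_iso ?bT3_iso.
Qed.

Let push (M : marking A) : marking B := [ffun q => M (g q)].

Lemma mem_push (I : {set A}) q : (q \in f @: I) = (g q \in I).
Proof. by rewrite -{1}(gK q) mem_imset //; apply: can_inj fK. Qed.

Lemma fires_b_iso M M' : fires (@transition_b A) M M' ->
  fires (@transition_b B) (push M) (push M').
Proof.
case=> I O tIO eI.
have -> : push (fire I O M) = fire (f @: I) (f @: O) (push M).
  by apply/ffunP=> q; rewrite !ffunE !mem_push.
apply: Fires; first exact: transition_b_iso.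
by move=> q; rewrite mem_push ffunE => /eI.
Qed.

Lemma in_Omega_b_iso : in_Omega_b A -> in_Omega_b B.
Proof.
case=> M rM DM; exists (push M); last by rewrite ffunE /bD -fC fK.
have -> : init_marking_b B = push (init_marking_b A).
  apply/ffunP=> q; rewrite !ffunE -{1 2 3}(gK q) bP_iso bQ_iso.
  by rewrite /bC -fC (can_eq fK).
elim: rM => [x y /fires_b_iso xy|x|x y z _ IH1 _ IH2].
- exact: rt_step.
- exact: rt_refl.
- exact: rt_trans IH1 IH2.
Qed.

End OmegaBIso.

Lemma Omega_b_iso (A B : structure sigma_b) :
  isomorphic A B -> in_Omega_b A -> in_Omega_b B.
Proof.
by case=> f isof; case: (isof) => -[g fK gK] _ _; apply: in_Omega_b_iso isof fK gK.
Qed.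

Definition Omega_b : problem sigma_b := Problem Omega_b_iso.

(* Main.v *)
Require Import Defs.
From mathcomp Require Import all_boot.
From Stdlib Require Import Relation_Operators ClassicalEpsilon.

(* Hardness: in an NPSB(1) scheme a cell only ever changes from [0] to [max], and
   there are finitely many program points. A configuration becomes one token on
   a place coding the program point and the values of the variables, together
   with one token per cell, lying on the [Q]-place of the cell while it holds
   [0] and on its twin outside [Q] once it holds [max]. Reading a cell is a
   [T_2] transition, writing it a [T_3] transition (or [T_2] if it already holds
   [max]), and every other step is a [T_1] transition. Quantifier-free formulas
   recognise these codes because [0] and [max] are distinct.

   Membership: at most one token ever lies in [P]; a place of [Q] outside [P]
   starts with one token and can only lose it; a place outside both that has a
   token keeps one. So the firing possibilities are determined by a variable
   holding the marked place of [P] and by an array whose cells change at most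
   once. *)

Set Implicit Arguments.
Unset Strict Implicit.
Unset Printing Implicit Defensive.

(** * Closures, list membership and classical booleans *)

Lemma clos_rt_invariant (T : Type) (R : T -> T -> Prop) (I : T -> Prop) :
  (forall x y, I x -> R x y -> I y) ->
  forall x y, clos_refl_trans _ R x y -> I x -> I y.
Proof.
move=> IR x y; elim=> [a b Rab Ia||a b c _ IH1 _ IH2 Ia] //.
- exact: IR Ia Rab.
- exact/IH2/IH1.
Qed.

Lemma In_nth (T : Type) (x0 x : T) s :
  List.In x s -> exists2 n, n < size s & x = nth x0 s n.
Proof.
elim: s => //= y s IH [<-|/IH[n ns ->]]; first by exists 0.
by exists n.+1.
Qed.

Lemma nth_In (T : Type) (x0 : T) s n : n < size s -> List.In (nth x0 s n) s.
Proof. by elim: s n => [|y s IH] [|n] //= ns; [left | right; apply: IH]. Qed.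

(** Instruction lists carry no boolean equality. The translation only has to exist, so classical
    logic may decide which program points coincide while the formulas are built. *)
Definition propb (P : Prop) : bool :=
  if excluded_middle_informative P then true else false.

Lemma propbP (P : Prop) : reflect P (propb P).
Proof. by rewrite /propb; case: excluded_middle_informative => ?; constructor. Qed.

(** * Substitution and finite connectives in quantifier-free formulas *)

Section Substitution.
Variables (sg : signature) (V V' : Type) (sub : V -> term sg V').

Definition tsubst (t : term sg V) : term sg V' :=
  match t with Var v => sub v | Cst c => Cst c end.

Fixpoint fsubst (f : qff sg V) : qff sg V' :=
  match f with
  | FRel _ ts => FRel (map_tuple tsubst ts)
  | FEq t u => FEq (tsubst t) (tsubst u)
  | FNot g => FNot (fsubst g)
  | FAnd g h => FAnd (fsubst g) (fsubst h)
  | FOr g h => FOr (fsubst g) (fsubst h)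
  end.

Variables (A : structure sg) (z m : A) (e : V' -> A) (e' : V -> A).
Hypothesis sub_e : forall v, term_val z m e (sub v) = e' v.

Lemma term_val_subst t : term_val z m e (tsubst t) = term_val z m e' t.
Proof. by case: t => /=. Qed.

Lemma holds_subst f : holds z m e (fsubst f) = holds z m e' f.
Proof.
elim: f => [r ts|t u|g IH|g IHg h IHh|g IHg h IHh] /=.
- congr rint; apply: val_inj; rewrite /= -map_comp.
  exact/eq_map/term_val_subst.
- by rewrite !term_val_subst.
- by rewrite IH.
- by rewrite IHg IHh.
- by rewrite IHg IHh.
Qed.

End Substitution.

Section BigConnectives.
Variables (sg : signature) (V : Type).

Definition ftrue : qff sg V := FEq (Cst Zero) (Cst Zero).
Definition fall (I : Type) (F : I -> qff sg V) (r : seq I) :=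
  foldr (fun i => FAnd (F i)) ftrue r.
Definition fsome (I : finType) (F : I -> qff sg V) :=
  foldr (fun i => FOr (F i)) (FNot ftrue) (enum I).

Variables (A : structure sg) (z m : A) (e : V -> A).

Lemma holds_fall (I : Type) (F : I -> qff sg V) r :
  holds z m e (fall F r) = all (fun i => holds z m e (F i)) r.
Proof. by elim: r => [|i r IH] /=; rewrite ?eqxx ?IH. Qed.

Lemma holds_fsome (I : finType) (F : I -> qff sg V) :
  holds z m e (fsome F) = [exists i, holds z m e (F i)].
Proof.
have -> : holds z m e (fsome F) = has (fun i => holds z m e (F i)) (enum I).
  by rewrite /fsome; elim: (enum I) => [|i r IH] /=; rewrite ?eqxx ?IH.
apply/hasP/existsP => [[i _ Fi]|[i Fi]]; exists i => //.
by rewrite mem_enum.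
Qed.

End BigConnectives.

(** * The step relation, computed from the head instruction *)

Section Steps.
Variables (sg : signature) (l m : nat) (ds : seq nat).
Variables (A : structure sg) (zero max : A) (fv : {ffun 'I_m -> A}).

(** Case analysis on the program then replaces inversion of [step], whose array constructors are
    dependently typed. *)
Definition next_config (c c' : config l m ds A) : Prop :=
  let: (k0, s) := c in
  match k0 with
  | [::] => False
  | Assign i y :: k => c' = (k, set_var s i (pterm_val zero max fv s y))
  | ArrRead i a ts :: k =>
      c' = (k, set_var s i (arrs s (cell_val zero max fv s ts)))
  | ArrWrite a ts y :: k =>
      c' = (k, set_cell s (cell_val zero max fv s ts)
                          (pterm_val zero max fv s y))
  | Guess i :: k => exists v, c' = (k, set_var s i v)
  | While f b :: k =>
      c' = (if holds zero max (env fv s) f then b ++ While f b :: k else k, s)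
  end.

Lemma stepE c c' : step zero max fv c c' <-> next_config c c'.
Proof.
split.
  by case=> //= [i v k s|f b k s ->|f b k s /negPf->] //; exists v.
case: c => [[|[i y|i a ts|a ts y|i|f b] k] s] //=.
- by move->; constructor.
- by move->; constructor.
- by move->; constructor.
- by case=> v ->; constructor.
- by move->; case: ifPn => H; constructor.
Qed.

End Steps.

(** * Finiteness of the set of program points *)

Section ProgramPoints.
Variables (sg : signature) (l m : nat) (ds : seq nat).
Implicit Types (i : instr sg l m ds) (b k : seq (instr sg l m ds)).

Definition succs k : seq (seq (instr sg l m ds)) :=
  match k with
  | [::] => [::]
  | While f b :: k' => [:: b ++ k; k']
  | _ :: k' => [:: k']
  end.

Definition npsb k := all (@instr_npsb sg l m ds) k.

(* The points of [b] followed by [k], the exit point [k] itself excluded. *)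
Definition points_of b k (S : seq (seq (instr sg l m ds))) : Prop :=
  [/\ List.In (b ++ k) (k :: S),
      forall x y, List.In x S -> List.In y (succs x) -> List.In y (k :: S)
    & npsb k -> forall x, List.In x S -> npsb x].

(** The exit [b ++ k] of the first instruction is the entry of the rest, so the two sets of points
    together can only be left through [k]. *)
Lemma points_of_cat i b k S S' : points_of [:: i] (b ++ k) S ->
  points_of b k S' -> points_of (i :: b) k (S ++ S').
Proof.
case=> iS cS nS [bS' cS' nS']; have bkS : List.In (b ++ k) (k :: S ++ S').
  by case: bS' => [<-|bS']; [left | right; apply/List.in_app_iff; right].
split.
- by case: iS => [E|iS]; [rewrite /= -[i :: _]E | right; apply/List.in_app_iff; left].
- move=> x y /List.in_app_iff[/cS H|/cS' H] /H [<- //|yS].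
  + by right; apply/List.in_app_iff; left.
  + by left.
  + by right; apply/List.in_app_iff; right.
- move=> nk x /List.in_app_iff[|/nS'//]; last exact.
  apply: nS; case: bS' => [<- //|bS']; exact: nS' bS'.
Qed.

Lemma points_of_simple i k : npsb [:: i] -> succs (i :: k) = [:: k] ->
  points_of [:: i] k [:: i :: k].
Proof.
move=> ni si; split; first by right; left.
- by move=> x y [<-|//]; rewrite si => -[<-|//]; left.
- by move=> nk x [<-|//]; move: ni; rewrite /npsb /= andbT => ->.
Qed.

(** The body of a loop exits into the loop itself, so adding that one point leaves [k] as the only
    exit. *)
Lemma points_of_while f b S k : npsb [:: While f b] ->
  points_of b (While f b :: k) S ->
  points_of [:: While f b] k ((While f b :: k) :: S).
Proof.
move=> nw [bS cS nS]; split; first by right; left.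
- move=> x y [<- /= [<-|[<-|//]]|xS ys]; [by right | by left |].
  by right; apply: cS xS ys.
- have nwk : npsb k -> npsb (While f b :: k).
    by move: nw; rewrite /npsb /= andbT => ->.
  by move=> nk x [<-|xS]; [apply: nwk | apply: nS xS; apply: nwk].
Qed.

(** Instructions are nested through lists, so a loop body is treated by an inner list induction that
    calls the fixpoint on its members only. *)
Fixpoint ex_instr_points i : npsb [:: i] -> forall k, exists S, points_of [:: i] k S.
Proof.
case: i => [i y|i a ts|a ts y|i|f b] ni k;
  try by eexists; apply: points_of_simple.
have nb : npsb b by move: ni; rewrite /npsb /= andbT.
suff [S bS] : exists S, points_of b (While f b :: k) S.
  by eexists; apply: points_of_while bS.
(* The continuation mentions the body, so it is made arbitrary before the induction on the body. *)
move: (While f b :: k) => {ni k}; elim: b nb => [|i b IH] nb k.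
  by exists [::]; split=> //; left.
have /andP[ni /IH/(_ k)[S' bS']] := nb.
have [|S iS] := ex_instr_points i _ (b ++ k); first by rewrite /npsb /= ni.
by exists (S ++ S'); apply: points_of_cat.
Qed.

Lemma ex_points b : npsb b -> exists (L : nat) (pt : 'I_L -> seq (instr sg l m ds)),
  [/\ exists n, b = pt n,
      forall n y, List.In y (succs (pt n)) -> exists n', y = pt n'
    & forall n, npsb (pt n)].
Proof.
move=> nb; have [S [bS cS nS]] : exists S, points_of b [::] S.
  move: [::]; elim: b nb => [|i b IH] nb k; first by exists [::]; split=> //; left.
  have /andP[ni /IH/(_ k)[S' bS']] := nb.
  have [|S iS] := @ex_instr_points i _ (b ++ k); first by rewrite /npsb /= ni.
  by exists (S ++ S'); apply: points_of_cat.
(* The exit [[::]] is adjoined: a finished computation needs a point too, and it has no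
   successors. *)
pose pts := [::] :: S.
have ptsP x : List.In x pts -> exists n : 'I_(size pts), x = nth [::] pts n.
  by case/(In_nth [::]) => n ns ->; exists (Ordinal ns).
have ptsI (n : 'I_(size pts)) : List.In (nth [::] pts n) pts by apply: nth_In.
exists (size pts), (fun n => nth [::] pts n); split.
- by apply: ptsP; move: bS; rewrite cats0.
- move=> n y yn; apply: ptsP; case: (ptsI n) => [E|/cS /(_ yn)//].
  by rewrite -E in yn.
- move=> n; case: (ptsI n) => [<- //|]; exact: nS.
Qed.

End ProgramPoints.

(** * The formulas of the translation *)

Section Translation.
Variables (sg : signature) (l : nat) (ds : seq nat).
Variables (L : nat) (pt : 'I_L -> seq (instr sg l 0 ds)).

(* A place carries one of these tags: [Some n] for a configuration at program
   point [n], [None] for the accepting place, [(false, a)] and [(true, a)] for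
   the cells of array [a] holding [0] and [max]. *)
Definition tag_type : finType := (option 'I_L + bool * asym ds)%type.
(** The data part stores either the [l] variables of a configuration or the indices of a cell; the
    sum leaves room for both. *)
Definition place_width := #|tag_type| + (l + \max_(a < size ds) dim a).

Lemma place_width_gt0 : 0 < place_width.
Proof.
rewrite /place_width addn_gt0; apply/orP; left.
by apply/card_gt0P; exists (inl None).
Qed.

(* The [j]-th component of a place: its tag in one-hot encoding, followed by
   its data [f]. *)
Definition place_comp (T : Type) (z m : T) (t : tag_type) (f : nat -> T) (j : nat) : T :=
  if j < #|tag_type| then if j == enum_rank t then m else z
  else f (j - #|tag_type|).

(** Padding with [z] gives each configuration exactly one code per program point. *)
Definition vdata (T : Type) (x : 'I_l -> T) (z : T) (j : nat) : T :=
  oapp x z (insub j).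

Lemma vdata_ord (T : Type) (x : 'I_l -> T) z (i : 'I_l) : vdata x z i = x i.
Proof. by rewrite /vdata valK. Qed.

(* The variable [(a, j)] is the [j]-th component of the [a]-th place. *)
Local Notation pterm := (term sg (nat * nat)).
Local Notation pform := (qff sg (nat * nat)).

Definition fcode (a : nat) (t : tag_type) (f : nat -> pterm) : pform :=
  fall (fun j => FEq (Var (a, j)) (place_comp (Cst Zero) (Cst Max) t f j))
       (iota 0 place_width).

Definition ftag (a : nat) (t : tag_type) : pform :=
  fall (fun j : nat => FEq (Var (a, j)) (Cst (if j == enum_rank t then Max else Zero)))
       (iota 0 #|tag_type|).

(** Program variables are read off the data of place 0, the configuration before the step. *)
Definition pvar_term (p : pvar l 0) : pterm :=
  match p with inl i => Var (0, #|tag_type| + i) | inr _ => Cst Zero end.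

Definition uvars (i : 'I_l) : pterm := pvar_term (inl i).
Definition uvars_upd (i : 'I_l) (y : pterm) (j : 'I_l) : pterm :=
  if j == i then y else uvars j.

(** Several indices may name the same point, so the disjunction admits each of them as a target. *)
Definition fgoto (k : seq (instr sg l 0 ds)) (f : 'I_l -> pterm) : pform :=
  fsome (fun n => if propb (k = pt n)
                  then fcode 1 (inl (Some n)) (vdata f (Cst Zero))
                  else FNot (ftrue _ _)).

Definition fcell (p : nat) (b : bool) (a : asym ds)
    (ts : (dim a).-tuple (term sg (pvar l 0))) : pform :=
  fcode p (inr (b, a)) (nth (Cst Zero) (map (tsubst pvar_term) ts)).

(** A guess leaves the new value free by comparing place 1 with its own component. The empty program
    leads to the accepting place if all variables are [max]. *)
Definition fT1 (n : 'I_L) : pform :=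
  match pt n with
  | [::] => FAnd (fcode 1 (inl None) (fun=> Cst Zero))
                 (fall (fun i => FEq (uvars i) (Cst Max)) (enum 'I_l))
  | Assign i y :: k => fgoto k (uvars_upd i (tsubst pvar_term y))
  | Guess i :: k => fgoto k (uvars_upd i (Var (1, #|tag_type| + i)))
  | While f b :: k =>
      FOr (FAnd (fsubst pvar_term f) (fgoto (b ++ While f b :: k) uvars))
          (FAnd (FNot (fsubst pvar_term f)) (fgoto k uvars))
  | _ => FNot (ftrue _ _)
  end.

Definition fT2 (n : 'I_L) : pform :=
  match pt n with
  | ArrRead i _ ts :: k =>
      FOr (FAnd (fcell 2 false ts) (fgoto k (uvars_upd i (Cst Zero))))
          (FAnd (fcell 2 true ts) (fgoto k (uvars_upd i (Cst Max))))
  | ArrWrite _ ts _ :: k => FAnd (fcell 2 true ts) (fgoto k uvars)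
  | _ => FNot (ftrue _ _)
  end.

Definition fT3 (n : 'I_L) : pform :=
  match pt n with
  | ArrWrite _ ts _ :: k =>
      FAnd (FAnd (fcell 2 false ts) (fcell 3 true ts)) (fgoto k uvars)
  | _ => FNot (ftrue _ _)
  end.

Definition at_point (F : 'I_L -> pform) : pform :=
  fsome (fun n => FAnd (fcode 0 (inl (Some n)) (vdata uvars (Cst Zero))) (F n)).

(** Only tags are inspected here. The formulas for [T_1], [T_2], [T_3] hold between codes only, so
    tuples that code nothing never gain or lose a token, wherever [P] and [Q] put them. *)
Definition fP : pform := FNot (fsome (fun ba => ftag 0 (inr ba))).
Definition fQ : pform := fsome (fun a => ftag 0 (inr (false, a))).

Definition rel_form (r : nat) : pform :=
  match r with
  | 0 => fP
  | 1 => fQ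
  | 2 => at_point fT1
  | 3 => at_point fT2
  | _ => at_point fT3
  end.

Definition ord_term (r : nat) (p : nat * nat) : term sg ('I_r * 'I_place_width) :=
  match insub p.1, insub p.2 with
  | Some a, Some j => Var (a, j)
  | _, _ => Cst Zero
  end.

Definition tag_csts (t : tag_type) : place_width.-tuple (csym sg) :=
  [tuple place_comp Zero Max t (fun=> Zero) j | j < place_width].

Definition scheme_translation (n0 : 'I_L) : qf_translation sg sigma_b :=
  @QfTranslation sg sigma_b place_width place_width_gt0
    (fun r => fsubst (@ord_term (arity r)) (rel_form r))
    (fun c => tag_csts (inl (if c == 0 :> nat then Some n0 else None))).

(** * Meaning of the formulas on codes, and the simulation in both directions *)

Section Semantics.
Variables (A : structure sg) (z m : A) (zm : z != m) (n0 : 'I_L).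

Local Notation place := (place_width.-tuple A).

Definition code (t : tag_type) (f : nat -> A) : place :=
  [tuple place_comp z m t f j | j < place_width].

Lemma nth_code t f j : j < place_width -> nth z (code t f) j = place_comp z m t f j.
Proof. by move=> jw; rewrite -(tnth_nth _ _ (Ordinal jw)) tnth_mktuple. Qed.

Lemma eq_code t f g : (forall j, f j = g j) -> code t f = code t g.
Proof. by move=> fg; apply: eq_mktuple => j; rewrite /place_comp fg. Qed.

(** At the position of [t] the first code has [m], and the second has [z] there unless the tags
    agree. *)
Lemma code_tag_inj t t' f f' : code t f = code t' f' -> t = t'.
Proof.
move=> E; have rw : enum_rank t < place_width.
  by apply: leq_trans (ltn_ord _) _; rewrite leq_addr.
have := nth_code t f rw; rewrite E nth_code // /place_comp ltn_ord eqxx.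
by case: eqP => [/val_inj/enum_rank_inj //|_ E']; case/eqP: zm.
Qed.

Lemma nth_code_data t f j : j < l + \max_(a < size ds) dim a ->
  nth z (code t f) (#|tag_type| + j) = f j.
Proof.
by move=> jw; rewrite nth_code ?ltn_add2l // /place_comp ltnNge leq_addr addKn.
Qed.

Definition pcode (n : 'I_L) (x : 'I_l -> A) : place :=
  code (inl (Some n)) (vdata x z).

Definition ccode (b : bool) (c : cell ds A) : place :=
  code (inr (b, tag c)) (nth z (tagged c)).

Lemma nth_pcode n x (i : 'I_l) : nth z (pcode n x) (#|tag_type| + i) = x i.
Proof. by rewrite nth_code_data ?vdata_ord // ltn_addr. Qed.

Lemma ccode_inj b b' c c' : ccode b c = ccode b' c' -> b = b' /\ c = c'.
Proof.
case: c c' => a t [a' t'] E; have [Eb Ea] := code_tag_inj E.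
rewrite /= in Eb Ea; subst b' a'; split=> //; congr Tagged.
apply: (@eq_from_tnth _ _ t t') => j; rewrite !(tnth_nth z).
have jw : j < l + \max_(a < size ds) dim a.
  by apply: ltn_addl; apply: leq_trans (ltn_ord j) (leq_bigmax a).
rewrite -(nth_code_data (inr (b, a)) (nth z t) jw).
by rewrite -(nth_code_data (inr (b, a)) (nth z t') jw);
  exact: (congr1 (fun u : place => nth z u _) E).
Qed.

Definition penv (us : seq place) (p : nat * nat) : A :=
  nth z (nth [::] (map val us) p.1) p.2.

Lemma holds_fcode us a t f (u : place) : nth [::] (map val us) a = u ->
  holds z m (penv us) (fcode a t f) =
  (u == code t (fun j => term_val z m (penv us) (f j))).
Proof.
move=> ua; rewrite holds_fall.
have compE j : term_val z m (penv us) (place_comp (Cst Zero) (Cst Max) t f j) =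
               place_comp z m t (fun j => term_val z m (penv us) (f j)) j.
  by rewrite /place_comp; case: ifP => // _; case: ifP.
apply/allP/eqP => [H|E j]; last first.
  rewrite mem_iota /= add0n => jw; rewrite compE /penv /= ua.
  by rewrite {1}E nth_code.
apply: val_inj; apply: (@eq_from_nth _ z); rewrite !size_tuple // => j jw.
have := H j; rewrite mem_iota /= add0n jw => /(_ isT)/eqP.
by rewrite compE nth_code // /penv /= ua.
Qed.

Lemma holds_ftag us a t t' f : nth [::] (map val us) a = code t f ->
  holds z m (penv us) (ftag a t') = (t == t').
Proof.
move=> ua; rewrite holds_fall.
have Kw j : j < #|tag_type| -> j < place_width.
  by move=> jK; apply: leq_trans jK _; rewrite leq_addr.
have penvE j : j < #|tag_type| -> penv us (a, j) = if j == enum_rank t then m else z.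
  by move=> jK; rewrite /penv /= ua nth_code ?Kw // /place_comp jK.
apply/allP/eqP => [H|<- j]; last first.
  by rewrite mem_iota /= add0n => jK; rewrite penvE //; case: ifP.
have := H (enum_rank t); rewrite mem_iota /= add0n ltn_ord => /(_ isT)/eqP.
rewrite penvE // eqxx; case: eqP => [/val_inj/enum_rank_inj //|_ /= E].
by case/eqP: zm.
Qed.

Local Notation net := (translate (scheme_translation n0) z m).

Lemma rintE (r : rsym sigma_b) (ts : (arity r).-tuple place) :
  @rint _ net r ts = holds z m (penv ts) (rel_form r).
Proof.
(* Out-of-range variables agree as well: [ord_term] yields the constant 0 and [penv] its default
   [z]. *)
apply: holds_subst => -[a j]; rewrite /ord_term /penv /=.
case: insubP => [a' _ Ea|aw] /=; last first.
  by rewrite [nth [::] _ _]nth_default ?nth_nil // size_map size_tuple leqNgt.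
case: insubP => [j' _ Ej|jw] /=.
  have tsE : nth [::] (map val ts) a = tnth ts a'.
    by rewrite -Ea (nth_map (tnth ts a')) ?size_tuple //= -tnth_nth.
  by rewrite tsE -Ej /= -tnth_nth.
rewrite nth_default // -Ea (nth_map (tnth ts a')) ?size_tuple //.
  by rewrite leqNgt.
exact: ltn_ord.
Qed.

Lemma bP_code t f : @bP net (code t f) = if t is inl _ then true else false.
Proof.
rewrite /bP rintE /= /fP /= holds_fsome.
under eq_existsb do rewrite (@holds_ftag _ _ t _ f) //.
case: t => [o|ba] /=; first by apply/existsP => -[].
by apply/negbTE/negPn/existsP; exists ba.
Qed.

Lemma bQ_code t f : @bQ net (code t f) = if t is inr (false, _) then true else false.
Proof.
rewrite /bQ rintE /= /fQ holds_fsome.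
under eq_existsb do rewrite (@holds_ftag _ _ t _ f) //.
case: t => [o|[[] a]] /=; try by apply/existsP => -[].
by apply/existsP; exists a.
Qed.

Lemma bC_code : bC net = pcode n0 (fun=> z).
Proof.
apply: eq_from_tnth => j; rewrite tnth_map !tnth_mktuple /place_comp.
case: ifP => _; first by case: ifP.
by rewrite /vdata; case: insub.
Qed.

Lemma bD_code : bD net = code (inl None) (fun=> z).
Proof.
apply: eq_from_tnth => j; rewrite tnth_map !tnth_mktuple /place_comp.
by case: ifP => _ //; case: ifP.
Qed.

Variable fv : {ffun 'I_0 -> A}.
Implicit Types (s : state l ds A) (us : seq place).

Lemma pvar_term_val n s us p :
  term_val z m (penv (pcode n (vars s) :: us)) (pvar_term p) = env fv s p.
Proof. by case: p => [i|[]//]; rewrite /= /penv nth_pcode. Qed.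

Lemma holds_at_point n s us F :
  holds z m (penv (pcode n (vars s) :: us)) (at_point F) =
  holds z m (penv (pcode n (vars s) :: us)) (F n).
Proof.
set e := penv _; rewrite holds_fsome; apply/existsP/idP => [[n']|Fn].
  rewrite /= (@holds_fcode _ _ _ _ (pcode n (vars s))) //.
  (* Distinct points have distinct tags, so only the disjunct of [n] can hold. *)
  by case/andP=> /eqP/code_tag_inj[->].
exists n; rewrite /= Fn andbT (@holds_fcode _ _ _ _ (pcode n (vars s))) //.
apply/eqP/eq_code => j; rewrite /vdata; case: insubP => //= i _ _.
by rewrite -[LHS](nth_pcode n).
Qed.

Definition goes (k : seq (instr sg l 0 ds)) s (v : place) : Prop :=
  exists2 n, k = pt n & v = pcode n (vars s).

Lemma holds_fgoto u v us k f s :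
  (forall i, term_val z m (penv (u :: v :: us)) (f i) = vars s i) ->
  holds z m (penv (u :: v :: us)) (fgoto k f) <-> goes k s v.
Proof.
move=> fE; rewrite holds_fsome.
have codeE n : code (inl (Some n))
    (fun j => term_val z m (penv (u :: v :: us)) (vdata f (Cst Zero) j)) =
    pcode n (vars s).
  by apply: eq_code => j; rewrite /vdata; case: insubP => //= i _ _; rewrite fE.
split=> [/existsP[n]|[n kn vE]].
  case: propbP => [kn|_]; last by rewrite /= eqxx.
  by rewrite (@holds_fcode _ _ _ _ v) // codeE => /eqP->; exists n.
apply/existsP; exists n; case: propbP => // _.
by rewrite (@holds_fcode _ _ _ _ v) // codeE vE.
Qed.

Lemma holds_fcell n s us p b (a : asym ds)
    (ts : (dim a).-tuple (term sg (pvar l 0))) (w : place) :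
  nth [::] (map val (pcode n (vars s) :: us)) p = w ->
  holds z m (penv (pcode n (vars s) :: us)) (fcell p b ts) =
  (w == ccode b (cell_val z m fv s ts)).
Proof.
move=> wp; rewrite (holds_fcode _ _ wp) /ccode /=; congr (_ == _).
apply: eq_code => j; have [jts|tsj] := ltnP j (size ts).
  rewrite !(nth_map (Cst Zero)) //.
  exact/term_val_subst/pvar_term_val.
by rewrite !nth_default ?size_map.
Qed.

Lemma uvars_upd_val n s v us i y a :
  term_val z m (penv (pcode n (vars s) :: v :: us)) y = a ->
  forall j, term_val z m (penv (pcode n (vars s) :: v :: us)) (uvars_upd i y j) =
            vars (set_var s i a) j.
Proof.
move=> ya j; rewrite ffunE /uvars_upd; case: eqP => // _.
exact: (pvar_term_val _ _ _ (inl j)).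
Qed.

Lemma bT1E n s v : @bT1 net (pcode n (vars s)) v <->
  match pt n with
  | [::] => (forall i, vars s i = m) /\ v = bD net
  | Assign i y :: k => goes k (set_var s i (pterm_val z m fv s y)) v
  | Guess i :: k => exists w, goes k (set_var s i w) v
  | While f b :: k =>
      goes (if holds z m (env fv s) f then b ++ While f b :: k else k) s v
  | _ => False
  end.
Proof.
rewrite bD_code /bT1 rintE /= (holds_at_point _ _ [:: v]) /fT1.
have pE := pvar_term_val n s [:: v].
case: (pt n) => [|[i y|i a ts|a ts y|i|f b] k].
- rewrite /= (@holds_fcode _ _ _ _ v) //= holds_fall.
  split=> [/andP[/eqP vD /allP H]|[H vD]].
    split=> // i; have := H i; rewrite mem_enum => /(_ isT)/eqP.
    by rewrite [term_val _ _ _ (uvars i)](pE (inl i)).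
  rewrite {1}vD eqxx; apply/allP => i _; apply/eqP.
  by rewrite -(H i); apply: (pE (inl i)).
- apply: holds_fgoto; apply: uvars_upd_val.
  exact: term_val_subst.
- by rewrite /= eqxx.
- by rewrite /= eqxx.
(* The guessed value is the one that [v] itself carries in component [i]. *)
- split=> [/holds_fgoto H|[w] vw].
    by eexists; apply: H; apply: uvars_upd_val; reflexivity.
  apply/holds_fgoto; last exact: vw; apply: uvars_upd_val.
  by case: vw => n' _ ->; rewrite /= /penv /= nth_pcode ffunE eqxx.
- rewrite /= (holds_subst pE).
  case: holds => /=; rewrite ?orbF; apply: holds_fgoto => i; exact: (pE (inl i)).
Qed.

Lemma bT2E n s v w : @bT2 net (pcode n (vars s)) v w <->
  match pt n with
  | ArrRead i a ts :: k => exists b : bool,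
      w = ccode b (cell_val z m fv s ts) /\
      goes k (set_var s i (if b then m else z)) v
  | ArrWrite a ts y :: k => w = ccode true (cell_val z m fv s ts) /\ goes k s v
  | _ => False
  end.
Proof.
rewrite /bT2 rintE /= (holds_at_point _ _ [:: v; w]) /fT2.
have pE := pvar_term_val n s [:: v; w].
case: (pt n) => [|[i y|i a ts|a ts y|i|f b] k]; try by rewrite /= eqxx.
  have goE c := holds_fgoto k (@uvars_upd_val n s v [:: w] i (Cst c) _ erefl).
  split=> [/= /orP[]|[b [wE]]].
  + rewrite (@holds_fcell _ _ _ _ _ _ _ w) // => /andP[/eqP wE /goE]; by exists false.
  + rewrite (@holds_fcell _ _ _ _ _ _ _ w) // => /andP[/eqP wE /goE]; by exists true.
  + rewrite /= !(@holds_fcell _ _ _ _ _ _ _ w) //.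
    by case: b wE => wE; [move/(goE Max) | move/(goE Zero)] => ->; rewrite -wE eqxx ?orbT.
rewrite /= (@holds_fcell _ _ _ _ _ _ _ w) //.
have goE := @holds_fgoto _ v [:: w] k uvars s (fun i => pE (inl i)).
by split=> [/andP[/eqP wE /goE]|[wE /goE->]] //; rewrite {1}wE eqxx.
Qed.

Lemma bT3E n s v w w' : @bT3 net (pcode n (vars s)) v w w' <->
  match pt n with
  | ArrWrite a ts y :: k =>
      [/\ w = ccode false (cell_val z m fv s ts),
          w' = ccode true (cell_val z m fv s ts) & goes k s v]
  | _ => False
  end.
Proof.
rewrite /bT3 rintE /= (holds_at_point _ _ [:: v; w; w']) /fT3.
have pE := pvar_term_val n s [:: v; w; w'].
case: (pt n) => [|[i y|i a ts|a ts y|i|f b] k]; try by rewrite /= eqxx.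
rewrite /= (@holds_fcell _ _ _ _ _ _ _ w) // (@holds_fcell _ _ _ _ _ _ _ w') //.
have goE := @holds_fgoto _ v [:: w; w'] k uvars s (fun i => pE (inl i)).
split=> [/andP[/andP[/eqP wE /eqP wE'] /goE]|[wE wE' /goE->]] //.
by rewrite {1}wE {1}wE' !eqxx.
Qed.

Hypothesis pt_closed : forall n y, List.In y (succs (pt n)) -> exists n', y = pt n'.
Hypothesis pt_npsb : forall n, npsb (pt n).

Local Notation ffires := (fires (@transition_b net)).

(** Outside [P] only codes of cells are constrained. The last clause makes exactly one of the two
    places of each cell marked. *)
Definition represents (p : net) (ar : {ffun cell ds A -> A}) (M : marking net) :=
  [/\ forall q, bP q -> M q = (q == p),
      forall c, M (ccode false c) = (ar c == z),
      forall c, M (ccode true c) = (ar c == m)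
    & forall c, ar c = z \/ ar c = m].

Lemma bP_ccode b c : @bP net (ccode b c) = false. Proof. exact: bP_code. Qed.
Lemma bQ_ccode b c : @bQ net (ccode b c) = ~~ b.
Proof. by rewrite bQ_code /=; case: b. Qed.

Lemma bP_neq (p q : net) : bP p -> bP q = false -> (q == p) = false.
Proof. by move=> Pp Pq; apply/eqP => E; rewrite E Pp in Pq. Qed.

Lemma represents_init :
  represents (pcode n0 (vars (init_state l ds z))) (arrs (init_state l ds z))
             (init_marking_b net).
Proof.
have CE : bC net = pcode n0 (vars (init_state l ds z)).
  rewrite bC_code; apply: eq_code => j.
  by rewrite /vdata; case: insub => //= i; rewrite ffunE.
have PC : @bP net (bC net) by rewrite bC_code bP_code.
split=> [q Pq|c|c|c].
- by rewrite ffunE Pq orbF CE.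
- by rewrite !ffunE eqxx bP_ccode bQ_ccode orbT.
- by rewrite !ffunE bP_ccode bQ_ccode (negPf zm) orbF bP_neq ?bP_ccode.
- by left; rewrite ffunE.
Qed.

Lemma represents_T1 (u v : net) ar (M : marking net) :
  bP u -> bP v -> represents u ar M ->
  represents v ar (fire [set u] [set v] M).
Proof.
move=> Pu Pv [MP M0 M1 arP]; split=> // [q Pq|c|c].
- by rewrite ffunE !inE MP // subnn.
- by rewrite ffunE !inE !bP_neq ?bP_ccode // subn0 addn0.
- by rewrite ffunE !inE !bP_neq ?bP_ccode // subn0 addn0.
Qed.

Lemma represents_T2 (u v w : net) ar (M : marking net) :
  bP u -> bP v -> ~~ bP w -> 0 < M w ->
  represents u ar M -> represents v ar (fire [set u; w] [set v; w] M).
Proof.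
move=> Pu Pv Pw Mw [MP M0 M1 arP].
(* The token of [w] is taken and put back; as subtraction is truncated, this needs [0 < M w]. *)
have MN q : bP q = false -> fire [set u; w] [set v; w] M q = M q.
  move=> Pq; rewrite ffunE !inE (bP_neq Pu Pq) (bP_neq Pv Pq) /=.
  by case: eqP => [->|_]; rewrite ?subn0 ?addn0 // subnK.
split=> // [q Pq|c|c]; [|by rewrite MN ?bP_ccode..].
have qw : (q == w) = false by apply/eqP => E; rewrite -E Pq in Pw.
by rewrite ffunE !inE qw !orbF MP // subnn.
Qed.

Lemma represents_T3 (u v : net) c ar (M : marking net) :
  bP u -> bP v -> 0 < M (ccode false c) ->
  represents u ar M ->
  represents v [ffun c' => if c' == c then m else ar c']
    (fire [set u; ccode false c] [set v; ccode true c] M).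
Proof.
move=> Pu Pv Mc [MP M0 M1 arP].
have ccE b b' c' : (ccode b c' == ccode b' c) = (b == b') && (c' == c).
  by apply/eqP/andP => [/ccode_inj[-> ->]|[/eqP-> /eqP->]].
have arc : ar c = z by apply/eqP; move: Mc; rewrite M0 lt0b.
split=> [q Pq|c'|c'|c'].
- have qw b : (q == ccode b c) = false.
    by apply/eqP => E; rewrite E bP_ccode in Pq.
  by rewrite ffunE !inE !qw !orbF MP // subnn.
- rewrite !ffunE !inE !ccE (bP_neq Pu) ?(bP_neq Pv) ?bP_ccode //= M0.
  by case: (c' =P c) => [->|_]; rewrite ?arc ?eqxx ?[m == z]eq_sym ?(negPf zm) ?subn0 ?addn0.
- rewrite !ffunE !inE !ccE (bP_neq Pu) ?(bP_neq Pv) ?bP_ccode //= M1.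
  by case: (c' =P c) => [->|_]; rewrite ?arc ?eqxx ?(negPf zm) ?subn0 ?addn0.
- by rewrite ffunE; case: ifP => // _; right.
Qed.

Lemma goesI n k s : List.In k (succs (pt n)) ->
  exists2 n', k = pt n' & goes k s (pcode n' (vars s)).
Proof. by move=> /pt_closed[n' kE]; exists n' => //; exists n'. Qed.

Lemma set_cell_id s c v : arrs s c = v -> set_cell s c v = s.
Proof.
case: s => x ar /= <-; congr State; apply/ffunP => c'.
by rewrite ffunE; case: eqP => // ->.
Qed.

(** This is where the restriction of NPSB(1) enters: every point satisfies [npsb], which admits only
    the constant [Max] as the written term. *)
Lemma write_max n a (ts : (dim a).-tuple _) y k s :
  pt n = ArrWrite ts y :: k -> pterm_val z m fv s y = m.
Proof. by have := pt_npsb n => /[swap] -> /andP[]; case: y => // -[]. Qed.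

Lemma step_fires n s k s' M : represents (pcode n (vars s)) (arrs s) M ->
  step z m fv (pt n, s) (k, s') ->
  exists n' M', [/\ k = pt n', ffires M M'
                  & represents (pcode n' (vars s')) (arrs s') M'].
Proof.
move=> rM /stepE; case: (rM) => MP M0 M1 arP.
have Mu : 0 < M (pcode n (vars s)) by rewrite MP ?eqxx ?bP_code.
have Pp n' x : @bP net (pcode n' x) by exact: bP_code.
have T1 n' s1 : bT1 (pcode n (vars s) : net) (pcode n' (vars s1)) ->
    arrs s1 = arrs s -> exists n2 M', [/\ pt n' = pt n2, ffires M M' &
      represents (pcode n2 (vars s1)) (arrs s1) M'].
  move=> T ar; exists n'; eexists; split=> //.
    by apply: Fires (TransT1 _ _ T) _ => // p /set1P->.
  by rewrite ar; apply: represents_T1.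
have T2 n' s1 b c : bT2 (pcode n (vars s) : net) (pcode n' (vars s1)) (ccode b c) ->
    arrs s c = (if b then m else z) ->
    arrs s1 = arrs s -> exists n2 M', [/\ pt n' = pt n2, ffires M M' &
      represents (pcode n2 (vars s1)) (arrs s1) M'].
  move=> T cb ar; exists n'.
  exists (fire [set (pcode n (vars s) : net); ccode b c]
               [set (pcode n' (vars s1) : net); ccode b c] M).
  have Mc : 0 < M (ccode b c) by case: b cb {T} => cb; rewrite ?M0 ?M1 cb eqxx.
  have en : enabled [set (pcode n (vars s) : net); ccode b c] M.
    by move=> p /set2P[]->.
  split=> //; last by rewrite ar; apply: represents_T2; rewrite ?bP_ccode.
  case: b {cb} T Mc en => T Mc en.
    by apply: Fires en; apply: TransT2NQ; rewrite ?bP_ccode ?bQ_ccode.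
  by apply: Fires en; apply: TransT2Q; rewrite ?bP_ccode ?bQ_ccode.
have := bT1E n s; have := bT2E n s; have := bT3E n s.
have := @goesI n; have := @write_max n.
case: (pt n) => [|[i y|i a ts|a ts y|i|f b] k0] //= wm gI T3E T2E T1E.
- case=> -> ->; have [|n' kE go] := gI k0 (set_var s i (pterm_val z m fv s y)).
    by left.
  rewrite kE.
  by apply: T1 => //; apply/T1E.
- case=> -> ->; set c := cell_val _ _ _ _ _.
  have [|n' kE go] := gI k0 (set_var s i (arrs s c)); [by left | rewrite kE].
  (* The boolean tells which of the two places of the cell carries its token. *)
  apply: (@T2 _ _ (arrs s c == m) c) => //; last first.
    by case: (arP c) => ->; rewrite ?eqxx ?(negPf zm).
  apply/T2E; eexists; split=> //.
  by case: (arP c) go => ->; rewrite ?eqxx ?(negPf zm).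
- rewrite (wm _ _ _ _ _ erefl); case=> -> ->; set c := cell_val _ _ _ _ _.
  have [|n' kE go] := gI k0 s; [by left | rewrite kE].
  (* Rewriting a cell that holds [max] changes nothing and is a [T_2] transition; the first write
     moves the token by [T_3]. *)
  case: (arP c) => cE; last first.
    rewrite set_cell_id //; apply: (@T2 _ _ true c) => //; exact/T2E.
  have Mc : 0 < M (ccode false c) by rewrite M0 cE eqxx.
  exists n', (fire [set (pcode n (vars s) : net); ccode false c]
                   [set (pcode n' (vars s) : net); ccode true c] M).
  split=> //; last exact: represents_T3.
  apply: Fires; last by move=> p /set2P[]->.
  by apply: TransT3; rewrite ?bP_ccode ?bQ_ccode //; apply/T3E.
- case=> v [-> ->]; have [|n' kE go] := gI k0 (set_var s i v); [by left | rewrite kE].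
  by apply: T1 => //; apply/T1E; exists v.
- case=> -> ->; set k1 := if _ then _ else _.
  have [|n' k1E go] := gI k1 s; last by rewrite k1E; apply: T1 => //; apply/T1E.
  by rewrite /k1; case: ifP => _; [left | right; left].
Qed.

(** The first alternative is the transition into the accepting place, which matches no step of the
    scheme. *)
Lemma fires_step n s M M' : represents (pcode n (vars s)) (arrs s) M ->
  ffires M M' ->
  (pt n = [::] /\ forall i, vars s i = m) \/
  exists n' s', step z m fv (pt n, s) (pt n', s') /\
                represents (pcode n' (vars s')) (arrs s') M'.
Proof.
move=> rM [I O T en]; case: (rM) => MP M0 M1 arP.
have fin k s1 v M2 : goes k s1 v -> step z m fv (pt n, s) (k, s1) ->
    represents v (arrs s1) M2 ->
    exists n' s', step z m fv (pt n, s) (pt n', s') /\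
                  represents (pcode n' (vars s')) (arrs s') M2.
  by case=> n' -> -> st rM2; exists n', s1.
have T2 v w M2 : bT2 (pcode n (vars s) : net) v w -> 0 < M w ->
    represents v (arrs s) M2 ->
    exists n' s', step z m fv (pt n, s) (pt n', s') /\
                  represents (pcode n' (vars s')) (arrs s') M2.
  move=> /bT2E; move: (@write_max n) fin.
  case: (pt n) => [|[i y|i a ts|a ts y|i|f b] k] //= wm fin.
  - set c := cell_val _ _ _ _ _; case=> b [-> go] Mc; apply: fin go _.
    have -> : (if b then m else z) = arrs s c.
      by case: b Mc; rewrite ?M0 ?M1 lt0b => /eqP.
    exact/stepE.
  - set c := cell_val _ _ _ _ _; case=> -> go.
    rewrite M1 lt0b => /eqP cm; apply: fin go _; apply/stepE => /=.
    by rewrite (wm _ _ _ _ _ erefl) set_cell_id.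
(* The current configuration is the only marked place of [P], so the transition must start there. *)
have uE (u : net) : bP u -> u \in I -> u = pcode n (vars s).
  by move=> Pu /en; rewrite MP // lt0b => /eqP.
case: T en uE => [u v Pu Pv T|u v w Pu Pv Pw Qw T|u v w Pu Pv Pw Qw T
       |u v w w' Pu Pv Pw Pw' Qw Qw' T] en /(_ u Pu) uE;
  (rewrite uE in Pu T en *; last by rewrite !inE eqxx).
- have := represents_T1 Pu Pv rM; move: (fire _ _ _) fin => M2 fin rM2.
  move/bT1E: T fin.
  case: (pt n) => [[H _] _|[i y|i a ts|a ts y|i|f b] k] //=; first by left.
  + by move=> go /(_ _ _ _ _ go) H; right; apply: H => //; apply/stepE.
  + by case=> x go /(_ _ _ _ _ go) H; right; apply: H => //; apply/stepE; exists x.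
  + by move=> go /(_ _ _ _ _ go) H; right; apply: H => //; apply/stepE.
- have Mw : 0 < M w by apply: en; rewrite !inE eqxx orbT.
  have := represents_T2 Pu Pv Pw Mw rM; move: (fire _ _ _) fin => M2 fin rM2.
  by right; apply: T2 T Mw rM2.
- have Mw : 0 < M w by apply: en; rewrite !inE eqxx orbT.
  have := represents_T2 Pu Pv Pw Mw rM; move: (fire _ _ _) fin => M2 fin rM2.
  by right; apply: T2 T Mw rM2.
- have Mw : 0 < M w by apply: en; rewrite !inE eqxx orbT.
  right; move/bT3E: T (@write_max n) fin.
  case: (pt n) => [|[i y|i a ts|a ts y|i|f b] k] //= [wE wE' go] wm fin.
  rewrite {}wE {}wE' in Mw *; set c := cell_val _ _ _ _ _ in Mw *.
  apply: (fin k (set_cell s c m) _ _ go); last exact: represents_T3.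
  by apply/stepE => /=; rewrite (wm _ _ _ _ _ erefl).
Qed.

Lemma translation_correct :
  in_Omega_b net <->
  exists2 s : state l ds A,
    clos_refl_trans _ (step z m fv) (pt n0, init_state l ds z) ([::], s)
    & forall i, vars s i = m.
Proof.
have PD : @bP net (bD net) by rewrite bD_code bP_code.
split=> [[M rM DM]|[s rs sm]].
  pose acc := exists2 s, clos_refl_trans _ (step z m fv)
    (pt n0, init_state l ds z) ([::], s) & forall i, vars s i = m.
  (* Once the accepting place is marked, the marking need not represent a configuration; the
     invariant then rests on [acc], which does not mention the marking. *)
  pose inv (M : marking net) := acc \/ exists n s,
    clos_refl_trans _ (step z m fv) (pt n0, init_state l ds z) (pt n, s) /\
    represents (pcode n (vars s)) (arrs s) M.
  suff [//|[n [s [_ [MP _ _ _]]]]] : inv M.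
    (* A represented marking has no token on [D], whose tag differs from that of every
       configuration. *)
    move: DM; rewrite MP // lt0b bD_code => /eqP/code_tag_inj; by [].
  apply: clos_rt_invariant rM _; last first.
    by right; exists n0, (init_state l ds z); split;
       [apply: rt_refl|apply: represents_init].
  move=> M1 M2 [|[n [s [rs rM1]]]
    /(fires_step rM1)[[n_nil sm]|[n' [s' [st rM2]]]]]; first by left.
    by left; exists s; rewrite -?n_nil.
  right; exists n', s'; split=> //.
  by apply: rt_trans rs _; apply: rt_step.
pose inv (c : config l 0 ds A) := exists n M, [/\ c.1 = pt n,
  reachable (@transition_b net) (init_marking_b net) M &
  represents (pcode n (vars c.2)) (arrs c.2) M].
have [n [M [/= nE rM repM]]] : inv ([::], s).
  apply: clos_rt_invariant rs _.
    move=> [k1 s1] [k2 s2] [n [M [/= -> rM repM]]]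
      /(step_fires repM)[n' [M' [-> MM' repM']]].
    by exists n', M'; split=> //; apply: rt_trans rM _; apply: rt_step.
  by exists n0, (init_marking_b net); split=> //; [apply: rt_refl|apply: represents_init].
case: repM => MP _ _ _.
exists (fire [set (pcode n (vars s) : net)] [set (bD net)] M); last first.
  by rewrite ffunE !inE eqxx addn1.
apply: rt_trans rM _; apply: rt_step; apply: Fires.
  by apply: TransT1; rewrite ?bP_code //; apply/bT1E; rewrite -nE.
by move=> p /set1P->; rewrite MP ?eqxx ?bP_code.
Qed.

End Semantics.
End Translation.

Lemma NPSB1_translates (sg : signature) (Omega : problem sg) :
  in_NPSB1 Omega -> qf_translates Omega Omega_b.
Proof.
case=> -[l f ds l0 ds0 b] [_ /= nb] [/= f0]; subst f => accO.
have [L [pt [[n0 bE] cpt npt]]] := ex_points nb.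
exists (scheme_translation pt n0) => A z m zm.
rewrite (accO A [ffun=> z] z m zm) /accepts /= bE.
by apply: iff_sym; apply: translation_correct.
Qed.

(** * Accepting runs, with and without a bound on their length *)

Section Runs.
Variables (sg : signature) (l m : nat) (ds : seq nat).
Variables (A : structure sg) (zero max : A) (fv : {ffun 'I_m -> A}).
Implicit Types (c : config l m ds A) (s : state l ds A).

Definition runs c :=
  exists2 s, clos_refl_trans _ (step zero max fv) c ([::], s)
           & forall i, vars s i = max.

(** The number bounds the steps instead of counting them, so an induction over rounds of a loop may
    spend it on one instruction per round only. *)
Fixpoint runs_in (n : nat) c : Prop :=
  (c.1 = [::] /\ forall i, vars c.2 i = max) \/
  if n is n'.+1 then exists2 c', next_config zero max fv c c' & runs_in n' c' else False.

Lemma runs_next c c' : next_config zero max fv c c' -> runs c' -> runs c.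
Proof.
move=> /stepE cc' [s rs sm]; exists s => //.
exact: rt_trans (rt_step _ _ _ _ cc') rs.
Qed.

Lemma runs_inS n c : runs_in n c -> runs_in n.+1 c.
Proof.
elim: n c => [|n IH] c [H|]; [by left|by []|by left|].
by case=> c' cc' /IH rc'; right; exists c'.
Qed.

Lemma runs_runs_in c : runs c -> exists n, runs_in n c.
Proof.
case=> s /Operators_Properties.clos_rt_rt1n_iff rs sm.
suff: forall c0, clos_refl_trans_1n _ (step zero max fv) c c0 ->
    c0 = ([::], s) -> exists n, runs_in n c by move/(_ _ rs); apply.
move=> c0; elim=> [x ->|x y w xy _ IH /IH[n rn]]; first by exists 0; left.
by exists n.+1; right; exists y => //; apply/stepE.
Qed.

Lemma runs_in_cons n i k s : runs_in n (i :: k, s) ->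
  exists n', n = n'.+1 /\
  exists2 c', next_config zero max fv (i :: k, s) c' & runs_in n' c'.
Proof. by case: n => [[[]|]|n [[]|H]] //; exists n. Qed.

Lemma runs_in_next n i k s : runs_in n (i :: k, s) ->
  exists2 c', next_config zero max fv (i :: k, s) c' & runs_in n c'.
Proof.
by case/runs_in_cons => n' [-> [c' cc' rc']]; exists c' => //; apply: runs_inS.
Qed.

Lemma runs_guess x v k s : runs (k, set_var s x v) -> runs (Guess _ _ _ x :: k, s).
Proof. by apply: runs_next; exists v. Qed.

(* A loop with an empty body diverges unless its test fails. *)
Definition assert (f : qff sg (pvar l m)) : instr sg l m ds := While (FNot f) [::].

Lemma runs_assert f k s : holds zero max (env fv s) f ->
  runs (k, s) -> runs (assert f :: k, s).
Proof. by move=> fs; apply: runs_next => /=; rewrite fs. Qed.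

(** A failing assertion returns to the same configuration at each step and so exhausts any bound. *)
Lemma runs_in_assert n f k s : runs_in n (assert f :: k, s) ->
  holds zero max (env fv s) f /\ runs_in n (k, s).
Proof.
elim: n => [|n IH]; first by case=> -[].
case=> [[]//|[c' /= ->]]; case fs: holds => /= H.
  by split=> //; apply: (runs_inS H).
by case: (IH H); rewrite fs.
Qed.

End Runs.

(** * A program scheme for the Petri net problem *)

Section Membership.

Local Notation pv := (pvar 7 0).
Local Notation tm := (term sigma_b pv).
Local Notation fm := (qff sigma_b pv).
Local Notation ins := (instr sigma_b 7 0 [:: 1]).

Definition xu : 'I_7 := @Ordinal 7 0 isT.
Definition xv : 'I_7 := @Ordinal 7 1 isT.
Definition xi : 'I_7 := @Ordinal 7 2 isT.
Definition xj : 'I_7 := @Ordinal 7 3 isT.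
Definition xa : 'I_7 := @Ordinal 7 4 isT.
Definition xt : 'I_7 := @Ordinal 7 5 isT.
Definition xg : 'I_7 := @Ordinal 7 6 isT.

Definition tv (i : 'I_7) : tm := Var (inl i).
Definition tC : tm := Cst (SigCst (@Ordinal 2 0 isT : 'I_(ncst sigma_b))).
Definition tD : tm := Cst (SigCst (@Ordinal 2 1 isT : 'I_(ncst sigma_b))).

Definition isP (x : tm) : fm := @FRel sigma_b pv (@Ordinal 5 0 isT) [tuple x].
Definition isQ (x : tm) : fm := @FRel sigma_b pv (@Ordinal 5 1 isT) [tuple x].
Definition isT1 (x y : tm) : fm := @FRel sigma_b pv (@Ordinal 5 2 isT) [tuple x; y].
Definition isT2 (x y i : tm) : fm :=
  @FRel sigma_b pv (@Ordinal 5 3 isT) [tuple x; y; i].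
Definition isT3 (x y i j : tm) : fm :=
  @FRel sigma_b pv (@Ordinal 5 4 isT) [tuple x; y; i; j].

Definition arr : asym [:: 1] := @Ordinal 1 0 isT.
Definition rd (x : 'I_7) (y : tm) : ins := @ArrRead sigma_b 7 0 [:: 1] x arr [tuple y].
Definition wr (y : tm) : ins := @ArrWrite sigma_b 7 0 [:: 1] arr [tuple y] (Cst Max).
Definition gs (x : 'I_7) : ins := Guess _ _ _ x.
Definition asg (x : 'I_7) (y : tm) : ins := Assign _ x y.

Local Notation "f &&& g" := (FAnd f g) (at level 40, left associativity).
Local Notation "f ||| g" := (FOr f g) (at level 50, left associativity).

Definition guard12 : fm :=
  isP (tv xu) &&& isP (tv xv) &&&
  (isT1 (tv xu) (tv xv) |||
   FNot (isP (tv xi)) &&& isT2 (tv xu) (tv xv) (tv xi) &&&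
   (isQ (tv xi) &&& FEq (tv xa) (Cst Zero) |||
    FNot (isQ (tv xi)) &&& FEq (tv xa) (Cst Max))).

Definition guard3 : fm :=
  isP (tv xu) &&& isP (tv xv) &&& FNot (isP (tv xi)) &&& FNot (isP (tv xj)) &&&
  isQ (tv xi) &&& FNot (isQ (tv xj)) &&& isT3 (tv xu) (tv xv) (tv xi) (tv xj) &&&
  FEq (tv xa) (Cst Zero).

(** The guessed [xt] selects the kind of transition, [max] standing for [T_3]; [xa] holds the
    content of cell [xi]. *)
Definition guard : fm :=
  FNot (FEq (tv xt) (Cst Max)) &&& guard12 ||| FEq (tv xt) (Cst Max) &&& guard3.

(** The first two disjuncts accept a [D] that is marked initially, even if its token has since been
    consumed; the other two look at the current marking. *)
Definition final : fm :=
  FEq tD tC ||| FNot (isP tD) &&& isQ tD ||| isP tD &&& FEq (tv xu) tD |||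
  FNot (isP tD) &&& FNot (isQ tD) &&& FEq (tv xa) (Cst Max).

(* Cell [i] of the array holds [max] once the token of a place [i] of [Q] has
   been consumed, and once a place [i] outside [Q] has received a token; [xu]
   is the marked place of [P]. *)
Definition move_tokens : ins :=
  While (FEq (tv xt) (Cst Max)) [:: wr (tv xi); wr (tv xj); asg xt (Cst Zero)].

(** The loop [move_tokens] serves as a conditional: its body resets [xt] and so runs at most
    once. *)
Definition fire_one : seq ins :=
  [:: gs xv; gs xi; gs xj; gs xt; rd xa (tv xi); assert _ guard;
      move_tokens; asg xu (tv xv)].

Definition finish : seq ins :=
  rd xa tD :: assert _ final :: [seq asg x (Cst Max) | x <- enum 'I_7].

(** Repeating the guess at the end of the body makes the program left after one round equal to
    [main_loop] again. *)
Definition main_loop : seq ins :=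
  gs xg :: While (FEq (tv xg) (Cst Max)) (fire_one ++ [:: gs xg]) :: finish.

Definition Omega_b_scheme : scheme sigma_b :=
  @Scheme sigma_b 7 0 [:: 1] isT isT (asg xu tC :: main_loop).

(** * Correctness of the scheme *)

Section Correctness.
Variables (N : structure sigma_b) (z m : N) (zm : z != m).
Variable fv : {ffun 'I_0 -> N}.
Implicit Types (s : state 7 [:: 1] N) (M : marking N).

Definition bcell (q : N) : cell [:: 1] N :=
  Tagged (fun a : asym [:: 1] => (dim a).-tuple N) ([tuple q] : (dim arr).-tuple N).

Lemma bcell_eq p q : (bcell p == bcell q) = (p == q).
Proof.
rewrite /bcell -tag_eqE /tag_eq eqxx /= tagged_asE.
by apply/eqP/eqP => [[]|->].
Qed.

Lemma cell_val1 s y :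
  @cell_val _ _ _ _ N z m fv s arr [tuple y] = bcell (pterm_val z m fv s y).
Proof. by congr Tagged; apply: val_inj. Qed.

Lemma holds_isP (e : pv -> N) x : holds z m e (isP x) = bP (term_val z m e x).
Proof. by rewrite /= /bP; congr rint; apply: val_inj. Qed.
Lemma holds_isQ (e : pv -> N) x : holds z m e (isQ x) = bQ (term_val z m e x).
Proof. by rewrite /= /bQ; congr rint; apply: val_inj. Qed.
Lemma holds_isT1 (e : pv -> N) x y :
  holds z m e (isT1 x y) = bT1 (term_val z m e x) (term_val z m e y).
Proof. by rewrite /= /bT1; congr rint; apply: val_inj. Qed.
Lemma holds_isT2 (e : pv -> N) x y i :
  holds z m e (isT2 x y i) =
  bT2 (term_val z m e x) (term_val z m e y) (term_val z m e i).
Proof. by rewrite /= /bT2; congr rint; apply: val_inj. Qed.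
Lemma holds_isT3 (e : pv -> N) x y i j :
  holds z m e (isT3 x y i j) =
  bT3 (term_val z m e x) (term_val z m e y) (term_val z m e i) (term_val z m e j).
Proof. by rewrite /= /bT3; congr rint; apply: val_inj. Qed.

Lemma holds_and (e : pv -> N) f g :
  holds z m e (f &&& g) = holds z m e f && holds z m e g.
Proof. by []. Qed.
Lemma holds_or (e : pv -> N) f g :
  holds z m e (f ||| g) = holds z m e f || holds z m e g.
Proof. by []. Qed.
Lemma holds_not (e : pv -> N) f : holds z m e (FNot f) = ~~ holds z m e f.
Proof. by []. Qed.

Definition T12_ok (u v i a : N) : bool :=
  [&& bP u, bP v &
      bT1 u v || [&& ~~ bP i, bT2 u v i & if bQ i then a == z else a == m]].
Definition T3_ok (u v i j a : N) : bool :=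
  [&& bP u, bP v, ~~ bP i, ~~ bP j, bQ i, ~~ bQ j, bT3 u v i j & a == z].

Lemma holds_guard s : holds z m (env fv s) guard =
  if vars s xt == m then T3_ok (vars s xu) (vars s xv) (vars s xi) (vars s xj) (vars s xa)
  else T12_ok (vars s xu) (vars s xv) (vars s xi) (vars s xa).
Proof.
rewrite /guard /guard12 /guard3 !(holds_or, holds_and, holds_not).
rewrite !(holds_isP, holds_isQ, holds_isT1, holds_isT2, holds_isT3) /=.
rewrite /T12_ok /T3_ok -!andbA.
by case: (vars s xt == m); rewrite /= ?orbF //; case: bQ; rewrite ?orbF.
Qed.

Lemma holds_final s : holds z m (env fv s) final =
  [|| bD N == bC N, ~~ bP (bD N) && bQ (bD N), bP (bD N) && (vars s xu == bD N)
    | [&& ~~ bP (bD N), ~~ bQ (bD N) & vars s xa == m]].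
Proof.
rewrite /final !(holds_or, holds_and, holds_not) !(holds_isP, holds_isQ) /=.
by rewrite -!andbA -!orbA.
Qed.

Lemma runs_set_max xs s : (forall x, x \in xs \/ vars s x = m) ->
  runs z m fv ([seq asg x (Cst Max) | x <- xs], s).
Proof.
elim: xs s => [|y xs IH] s xsm.
  by exists s; [apply: rt_refl | move=> x; case: (xsm x)].
apply: runs_next => //=; apply: IH => x; rewrite ffunE.
case: eqP => [_|xy]; first by right.
by case: (xsm x); [rewrite inE => /predU1P[]; [|left] | right].
Qed.

(* If [C] is not in [P], it may hold a token that the array does not record,
   but then no transition is enabled. *)
Definition tracks (u : N) (ar : {ffun cell [:: 1] N -> N}) M :=
  [/\ forall q, bP q -> M q = (q == u),
      forall q, ~~ bP q -> bQ q -> M q = (ar (bcell q) == z),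
      forall q, ~~ bP q -> ~~ bQ q -> (0 < M q) = (ar (bcell q) == m) || (q == bC N)
    & bP u -> bP (bC N)].

Lemma tracks_init : tracks (bC N) [ffun=> z] (init_marking_b N).
Proof.
split=> // q Pq => [|Qq|Qq]; rewrite !ffunE ?Pq ?Qq ?orbF ?orbT ?eqxx //=.
by rewrite (negPf Qq) (negPf zm) orbF lt0b.
Qed.

Lemma not_bP_neq (p q : N) : bP p -> ~~ bP q -> (q == p) = false.
Proof. by move=> Pp; apply: contraNF => /eqP->. Qed.

Lemma tracks_T1 u v ar M : bP u -> bP v -> tracks u ar M ->
  tracks v ar (fire [set u] [set v] M).
Proof.
move=> Pu Pv [MP MQ MN uC]; split=> [q Pq|q Pq Qq|q Pq Qq|_]; last exact: uC.
- by rewrite ffunE !inE MP // subnn.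
- by rewrite ffunE !inE (not_bP_neq Pu Pq) (not_bP_neq Pv Pq) subn0 addn0 MQ.
- by rewrite ffunE !inE (not_bP_neq Pu Pq) (not_bP_neq Pv Pq) subn0 addn0 MN.
Qed.

Lemma tracks_T2 u v i ar M : bP u -> bP v -> ~~ bP i -> 0 < M i ->
  tracks u ar M -> tracks v ar (fire [set u; i] [set v; i] M).
Proof.
move=> Pu Pv Pi Mi [MP MQ MN uC].
have keep q : ~~ bP q -> fire [set u; i] [set v; i] M q = M q.
  move=> Pq; rewrite ffunE !inE (not_bP_neq Pu Pq) (not_bP_neq Pv Pq) /=.
  by case: eqP => [->|_]; rewrite ?subn0 ?addn0 // subnK.
split=> [q Pq|q Pq Qq|q Pq Qq|_]; last exact: uC.
- by rewrite ffunE !inE [q == i]eq_sym (not_bP_neq Pq Pi) !orbF MP // subnn.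
- by rewrite keep // MQ.
- by rewrite keep // MN.
Qed.

(** The place [i] has a single token and loses it for good, while [j] may collect several, of which
    only the presence is recorded. *)
Lemma tracks_T3 u v i j s M : bP u -> bP v -> ~~ bP i -> ~~ bP j ->
  bQ i -> ~~ bQ j -> 0 < M i -> tracks u (arrs s) M ->
  tracks v (arrs (set_cell (set_cell s (bcell i) m) (bcell j) m))
    (fire [set u; i] [set v; j] M).
Proof.
move=> Pu Pv Pi Pj Qi Qj Mi [MP MQ MN uC].
have ij : (i == j) = false by apply: contraNF Qj => /eqP<-.
split=> [q Pq|q Pq Qq|q Pq Qq|_]; last exact: uC.
- rewrite ffunE !inE ![q == _]eq_sym (not_bP_neq Pq Pi) (not_bP_neq Pq Pj).
  by rewrite !orbF [u == q]eq_sym MP // subnn eq_sym.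
- have qj : (q == j) = false by apply: contraNF Qj => /eqP<-.
  rewrite !ffunE !inE !bcell_eq qj (not_bP_neq Pu Pq) (not_bP_neq Pv Pq) /= addn0.
  rewrite MQ //; case: (q =P i) => [->|_]; last by rewrite subn0.
  by rewrite [m == z]eq_sym (negPf zm); case: eqP.
- have qi : (q == i) = false by apply: contraNF Qq => /eqP->.
  rewrite !ffunE !inE !bcell_eq qi (not_bP_neq Pu Pq) (not_bP_neq Pv Pq) /= subn0.
  by rewrite addn_gt0 MN // lt0b; case: (q =P j); rewrite ?eqxx ?orbT ?orbF.
Qed.

Local Notation moved s i j := (set_cell (set_cell s (bcell i) m) (bcell j) m).

Lemma T12_ok_fires u v i ar M : tracks u ar M -> T12_ok u v i (ar (bcell i)) ->
  exists2 M', fires (@transition_b N) M M' & tracks v ar M'.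
Proof.
move=> tM /and3P[Pu Pv]; have [MP MQ MN _] := tM.
have Mu : 0 < M u by rewrite MP ?eqxx.
case/orP => [T|/and3P[Pi T ai]].
  eexists; last exact: tracks_T1 tM.
  by apply: Fires (TransT1 _ _ T) _ => // p /set1P->.
have Mi : 0 < M i.
  case: ifP ai => [Qi /eqP ai|/negbT Qi /eqP ai]; first by rewrite MQ ?ai ?eqxx.
  by rewrite MN ?ai ?eqxx.
exists (fire [set u; i] [set v; i] M); last exact: tracks_T2 tM.
apply: Fires; last by move=> p /set2P[]->.
by case: (boolP (bQ i)) => Qi; [apply: TransT2Q | apply: TransT2NQ].
Qed.

Lemma T3_ok_fires u v i j s M : tracks u (arrs s) M ->
  T3_ok u v i j (arrs s (bcell i)) ->
  exists2 M', fires (@transition_b N) M M' & tracks v (arrs (moved s i j)) M'.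
Proof.
move=> tM; have [MP MQ MN _] := tM.
rewrite /T3_ok; case/andP=> Pu /and5P[Pv Pi Pj Qi /and3P[Qj T /eqP ai]].
have Mu : 0 < M u by rewrite MP ?eqxx.
have Mi : 0 < M i by rewrite MQ ?ai ?eqxx.
exists (fire [set u; i] [set v; j] M); last exact: tracks_T3 tM.
by apply: Fires; [apply: TransT3 | move=> p /set2P[]->].
Qed.

Lemma fires_ok u s M M' : tracks u (arrs s) M -> fires (@transition_b N) M M' ->
  exists v i j,
    (T12_ok u v i (arrs s (bcell i)) /\ tracks v (arrs s) M') \/
    (T3_ok u v i j (arrs s (bcell i)) /\ tracks v (arrs (moved s i j)) M').
Proof.
move=> tM [I O T en]; have [MP MQ MN uC] := tM.
have uE (u' : N) : bP u' -> u' \in I -> u' = u.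
  by move=> Pu' /en; rewrite MP // lt0b => /eqP.
case: T en uE => [u' v Pu Pv T|u' v i Pu Pv Pi Qi T|u' v i Pu Pv Pi Qi T
       |u' v i j Pu Pv Pi Pj Qi Qj T] en /(_ u' Pu) uE;
  (rewrite uE in Pu T en *; last by rewrite !inE eqxx).
- by exists v, z, z; left; split; [rewrite /T12_ok Pu Pv T | apply: tracks_T1].
- have Mi : 0 < M i by apply: en; rewrite !inE eqxx orbT.
  exists v, i, i; left; split; last exact: tracks_T2.
  by move: Mi; rewrite /T12_ok Pu Pv Pi T Qi MQ // lt0b => ->; rewrite orbT.
- have Mi : 0 < M i by apply: en; rewrite !inE eqxx orbT.
  exists v, i, i; left; split; last exact: tracks_T2.
  (* Since [u] lies in [P], so does [C]; hence [i] is not [C] and the array records its token. *)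
  move: Mi; rewrite /T12_ok Pu Pv Pi T (negPf Qi) MN // (not_bP_neq (uC Pu) Pi) orbF.
  by move=> ->; rewrite orbT.
- have Mi : 0 < M i by apply: en; rewrite !inE eqxx orbT.
  exists v, i, j; right; split; last exact: tracks_T3.
  by move: Mi; rewrite /T3_ok Pu Pv Pi Pj Qi Qj T MQ // lt0b.
Qed.

Lemma pterm_val_var s x : pterm_val z m fv s (tv x) = vars s x.
Proof. by []. Qed.

Lemma vars_set_var s x y a : vars (set_var s y a) x = if x == y then a else vars s x.
Proof. exact: ffunE. Qed.

(** The memory just before the assertion of a round. Later proofs abstract it and keep only what
    [loadedP] and [guard_loaded] say. *)
Definition loaded s (g v i j t : N) :=
  set_var (set_var (set_var (set_var (set_var (set_var s xg g) xv v) xi i) xj j) xt t)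
    xa (arrs s (bcell i)).

Lemma read_loaded s g v i j t :
  let s' := set_var (set_var (set_var (set_var (set_var s xg g) xv v) xi i) xj j) xt t in
  set_var s' xa (arrs s' (@cell_val _ _ _ _ N z m fv s' arr [tuple tv xi])) =
  loaded s g v i j t.
Proof. by move=> s'; rewrite cell_val1 pterm_val_var /s' !vars_set_var. Qed.

Lemma loadedP s g v i j t (s' := loaded s g v i j t) :
  [/\ vars s' xv = v, vars s' xi = i, vars s' xj = j, vars s' xt = t
    & arrs s' = arrs s].
Proof. by split; rewrite // /s' /loaded !vars_set_var /=. Qed.

Lemma guard_loaded s g v i j t : holds z m (env fv (loaded s g v i j t)) guard =
  if t == m then T3_ok (vars s xu) v i j (arrs s (bcell i))
  else T12_ok (vars s xu) v i (arrs s (bcell i)).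
Proof.
rewrite holds_guard; have [-> -> -> -> _] := loadedP s g v i j t.
by rewrite /loaded !vars_set_var /=.
Qed.

Lemma holds_is_max s x :
  holds z m (env fv s) (FEq (tv x) (Cst Max)) = (vars s x == m).
Proof. by []. Qed.


Lemma runs_in_main_loop n s M :
  reachable (@transition_b N) (init_marking_b N) M -> tracks (vars s xu) (arrs s) M ->
  runs_in z m fv n (main_loop, s) -> in_Omega_b N.
Proof.
elim: n s M => [|n IH] s M rM tM; first by case=> -[].
(* The leading guess lowers the bound for the induction; all other instructions of the round keep
   it. *)
case/runs_in_cons => _ [[<-] [_ [g ->]]].
case/runs_in_next => _ /= ->; case: ifP => _; last first.
  case/runs_in_next => _ ->; case/runs_in_assert.
  rewrite holds_final cell_val1 /pterm_val !ffunE /= -/(bD N) => fin _.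
  have [MP MQ MN _] := tM.
  case/or4P: fin => [/eqP DC|/andP[PD QD]|/andP[PD /eqP uD]|/and3P[PD QD /eqP aD]].
  + by exists (init_marking_b N); [apply: rt_refl | rewrite ffunE DC eqxx].
  + by exists (init_marking_b N); [apply: rt_refl | rewrite ffunE PD QD orbT].
  + by exists M => //; rewrite MP // uD eqxx.
  + by exists M => //; rewrite MN // aD eqxx.
case/runs_in_next => _ [v ->]; case/runs_in_next => _ [i ->].
case/runs_in_next => _ [j ->]; case/runs_in_next => _ [t ->].
case/runs_in_next => _ ->; rewrite read_loaded; case/runs_in_assert.
rewrite guard_loaded => gd; case/runs_in_next => _ ->.
rewrite holds_is_max; have [+ + + + +] := loadedP s g v i j t.
move: (loaded s g v i j t) => s1 vE iE jE tE arE; rewrite tE.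
case: ifP gd => tm gd.
  case/runs_in_next => _ ->; case/runs_in_next => _ ->.
  case/runs_in_next => _ ->; case/runs_in_next => _ ->.
  rewrite holds_is_max vars_set_var eqxx (negPf zm).
  case/runs_in_next => _ ->.
  have [M' MM' tM'] := T3_ok_fires tM gd; apply: (IH _ M').
    exact: rt_trans rM (rt_step _ _ _ _ MM').
  rewrite !vars_set_var eqxx pterm_val_var !vars_set_var !cell_val1 !pterm_val_var /=.
  by rewrite iE jE vE arE.
case/runs_in_next => _ ->.
have [M' MM' tM'] := T12_ok_fires tM gd; apply: (IH _ M').
  exact: rt_trans rM (rt_step _ _ _ _ MM').
by rewrite vars_set_var eqxx pterm_val_var vE /= arE.
Qed.

Lemma runs_main_loop s M M' : tracks (vars s xu) (arrs s) M ->
  fires (@transition_b N) M M' ->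
  exists2 s', tracks (vars s' xu) (arrs s') M' &
    runs z m fv (main_loop, s') -> runs z m fv (main_loop, s).
Proof.
move=> tM MM'; have [v [i [j ok]]] := fires_ok tM MM'.
pose k := fire_one ++ main_loop.
(* Guessing [m] for [xg] enters the loop; the five dropped instructions are the four guesses and the
   read. *)
have start t : runs z m fv (drop 5 k, loaded s m v i j t) -> runs z m fv (main_loop, s).
  move=> rk; apply: (runs_guess (v := m)).
  apply: runs_next; [reflexivity|]; rewrite holds_is_max vars_set_var !eqxx.
  apply: (runs_guess (v := v)); apply: (runs_guess (v := i)).
  apply: (runs_guess (v := j)); apply: (runs_guess (v := t)).
  by apply: runs_next; [reflexivity|]; rewrite read_loaded.
(* The guess for [xt] is [z] for a [T_1] or [T_2] transition and [m] for [T_3]. *)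
case: ok => -[ok tM'].
  move: (start z) (guard_loaded s m v i j z).
  have [+ + + + +] := loadedP s m v i j z.
  move: (loaded s m v i j z) => s1 vE iE jE tE arE {}start gd.
  exists (set_var s1 xu v); first by rewrite vars_set_var eqxx /= arE.
  move=> r; apply: start; apply: runs_assert; first by rewrite gd (negPf zm).
  apply: runs_next; [reflexivity|]; rewrite holds_is_max tE (negPf zm).
  by apply: runs_next; [reflexivity|]; rewrite pterm_val_var vE.
move: (start m) (guard_loaded s m v i j m).
have [+ + + + +] := loadedP s m v i j m.
move: (loaded s m v i j m) => s1 vE iE jE tE arE {}start gd.
exists (set_var (set_var (moved s1 i j) xt z) xu v).
  by rewrite vars_set_var eqxx /= arE.
move=> r; apply: start; apply: runs_assert; first by rewrite gd eqxx.
apply: runs_next; [reflexivity|]; rewrite holds_is_max tE eqxx.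
apply: runs_next; [reflexivity|]; apply: runs_next; [reflexivity|].
apply: runs_next; [reflexivity|]; apply: runs_next; [reflexivity|].
rewrite holds_is_max vars_set_var eqxx (negPf zm).
apply: runs_next; [reflexivity|].
by rewrite pterm_val_var vars_set_var !cell_val1 !pterm_val_var /= vE iE jE.
Qed.

Lemma runs_finish s M : tracks (vars s xu) (arrs s) M -> 0 < M (bD N) ->
  runs z m fv (main_loop, s).
Proof.
move=> [MP MQ MN _] DM.
apply: (runs_guess (v := z)).
apply: runs_next => //=; rewrite ffunE /= (negPf zm).
apply: runs_next => //; apply: runs_assert; last first.
  by apply: runs_set_max => x; left; rewrite mem_enum.
rewrite holds_final cell_val1 /pterm_val !ffunE /= -/(bD N).
move: DM; case: (boolP (bP (bD N))) => PD.
  by rewrite MP // lt0b eq_sym => ->; rewrite !orbT.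
case: (boolP (bQ (bD N))) => QD; first by rewrite orbT.
by rewrite MN // => /orP[]->; rewrite ?orbT.
Qed.

Lemma accepts_Omega_b : in_Omega_b N <-> @accepts _ Omega_b_scheme N z m fv.
Proof.
have ini : tracks (vars (set_var (init_state 7 [:: 1] z) xu (bC N)) xu)
    (arrs (init_state 7 [:: 1] z)) (init_marking_b N).
  by rewrite ffunE eqxx; apply: tracks_init.
split=> [[M rM DM]|].
  (* The end of the run is known only at the last marking, so the invariant says that an accepting
     run from [s] extends backwards to one of the whole scheme. *)
  pose inv M' := exists2 s, tracks (vars s xu) (arrs s) M' &
    runs z m fv (main_loop, s) ->
    runs z m fv (body Omega_b_scheme, init_state 7 [:: 1] z).
  suff [s tM rs] : inv M.
    exact/rs/(runs_finish tM).
  apply: clos_rt_invariant rM _.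
    move=> M1 M2 [s tM1 rs] /(runs_main_loop tM1)[s' tM2 rs'].
    by exists s' => // /rs'.
  by eexists; [exact: ini | apply: runs_next].
case/runs_runs_in => n /runs_in_next[_ ->].
by apply: runs_in_main_loop; [apply: rt_refl | exact: ini].
Qed.

End Correctness.

(** Acceptance is independent of 0 and [max] because it is equivalent to [in_Omega_b], which
    mentions neither. *)
Lemma Omega_b_in_NPSB1 : in_NPSB1 Omega_b.
Proof.
exists Omega_b_scheme.
  split=> [N fv z m z' m' zm zm'|].
    by split=> /accepts_Omega_b; [move/(_ zm)|move/(_ zm')] => ?; apply/accepts_Omega_b.
  rewrite /= all_map; apply/allP => x _; by [].
by split=> // N fv z m zm; apply: accepts_Omega_b.
Qed.

End Membership.

Theorem theorem6 :
  (forall (sg : signature) (Omega : problem sg),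
     in_NPSB1 Omega -> qf_translates Omega Omega_b)
  /\ NPSB1_complete Omega_b.
Proof.
by split; [|split; [exact: Omega_b_in_NPSB1|]] => sg Omega; apply: NPSB1_translates.
Qed.
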